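(* Let $c(x,y)=\|x-y\|^2$ on $\mathbb{R}^d\times\mathbb{R}^d$. Let $\Omega\subseteq\mathbb{R}^d$ be a star-shaped set with centre at $z'\in\mathbb{R}^d$, and let $\mathcal{Y}\subseteq\mathbb{R}^d$ be compact. Let $q\ge1$ (real). Then for each $M>0$ there exists a constant $C=C(M,z',\mathcal{Y})>0$ such that for all $\rho\in\mathcal{P}_2(\mathbb{R}^d)$ with $\int\|x\|^{q/2}\,\mathrm{d}\rho(x)\le M$ and all $\mu\in\mathcal{P}(\mathcal{Y})$, the set $\Phi_c(\rho,\mu)$ is non-empty and $$\operatorname{diam}_{L^q}(\Phi_c(\rho,\mu))\le C\left(d_H(\operatorname{spt}\rho,\Omega)^{1/2}+d_H(\operatorname{spt}\rho,\Omega)\right).$$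
   Context: $\mathcal{P}(\mathcal{Y})$ is the set of Borel probability measures on $\mathcal{Y}$, $\mathcal{P}_2(\mathbb{R}^d)$ those on $\mathbb{R}^d$ with finite second moment; $\operatorname{spt}$ is the support. A point $z'$ is a centre of the star-shaped set $\Omega$ if $[z',z]\subseteq\Omega$ for every $z\in\Omega$. Hausdorff distance: $d_H(A,B):=\max\{\sup_{x\in A}d(x,B),\sup_{x\in B}d(x,A)\}\in[0,+\infty]$. Dual optimal transport problem: maximise $\int\phi\,\mathrm{d}\rho+\int\psi\,\mathrm{d}\mu$ over $(\phi,\psi)\in L^1(\rho)\times L^1(\mu)$ (pointwise defined functions with values in $\mathbb{R}\cup\{-\infty\}$) subject to $\phi(x)+\psi(y)\le c(x,y)$ for all $(x,y)\in\mathbb{R}^d\times\mathbb{R}^d$. The set of $\rho$-side Kantorovich potentials is $$\Phi_c(\rho,\mu):=\{\phi\in L^1(\rho):\exists\,\psi\in L^1(\mu)\text{ with }(\phi,\psi)\text{ optimal for the dual problem}\},$$ and $\operatorname{diam}_{L^q}(\Phi_c(\rho,\mu)):=\sup_{\phi_0,\phi_1\in\Phi_c(\rho,\mu)}\inf_{l\in\mathbb{R}}\|\phi_0-\phi_1-l\|_{L^q(\rho)}$. *)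

(* Defs.v *)
From HB Require Import structures.
From mathcomp Require Import all_boot all_order all_algebra.
From mathcomp Require Import all_classical all_reals all_analysis.
Import Order.TTheory GRing.Theory Num.Theory.
Import numFieldNormedType.Exports.

Set Implicit Arguments.
Unset Strict Implicit.
Unset Printing Implicit Defensive.

Local Open Scope classical_set_scope.
Local Open Scope ring_scope.

(* R^d carries the Borel sigma-algebra of the topology of 'rV[R]_d, which is
   the Euclidean topology; the norm of 'rV[R]_d in the library is the
   sup-norm, hence the separate Euclidean norm below. *)
Notation borelV R d := (g_sigma_algebraType (@open 'rV[R]_d)).

Definition enorm (R : realType) (d : nat) (x : 'rV[R]_d) : R :=
  Num.sqrt (\sum_(i < d) x ord0 i ^+ 2).

Definition sqdist (R : realType) (d : nat) (x y : 'rV[R]_d) : R :=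
  enorm (x - y) ^+ 2.

Definition star_center (R : realType) (d : nat) (Omega : set 'rV[R]_d)
    (z' : 'rV[R]_d) : Prop :=
  forall z, Omega z ->
    forall t : R, 0 <= t <= 1 -> Omega ((1 - t) *: z' + t *: z).

Local Open Scope ereal_scope.

Definition spt (R : realType) (d : nat) (rho : probability (borelV R d) R) :
    set 'rV[R]_d :=
  [set x | forall U : set 'rV[R]_d, open U -> U x -> 0 < rho U].

(* +oo when A is empty *)
Definition set_dist (R : realType) (d : nat) (x : 'rV[R]_d)
    (A : set 'rV[R]_d) : \bar R :=
  ereal_inf [set (enorm (x - a))%:E | a in A].

(* Takes its values in [0, +oo] as soon as A or B is nonempty; the library's
   convention sup set0 = -oo makes it -oo when both are empty. *)
Definition hausdorff_dist (R : realType) (d : nat) (A B : set 'rV[R]_d) :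
    \bar R :=
  maxe (ereal_sup [set set_dist x B | x in A])
       (ereal_sup [set set_dist x A | x in B]).

Definition finite_second_moment (R : realType) (d : nat)
    (rho : probability (borelV R d) R) : Prop :=
  \int[rho]_x (enorm x ^+ 2)%:E < +oo.

Definition dual_admissible (R : realType) (d : nat)
    (c : 'rV[R]_d -> 'rV[R]_d -> R) (rho mu : probability (borelV R d) R)
    (phi psi : 'rV[R]_d -> \bar R) : Prop :=
  [/\ (forall x, phi x != +oo) /\ (forall y, psi y != +oo),
      rho.-integrable setT (phi : borelV R d -> \bar R),
      mu.-integrable setT (psi : borelV R d -> \bar R) &
      forall x y, phi x + psi y <= (c x y)%:E].

Definition dual_value (R : realType) (d : nat)
    (rho mu : probability (borelV R d) R)
    (phi psi : 'rV[R]_d -> \bar R) : \bar R :=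
  \int[rho]_x phi x + \int[mu]_y psi y.

Definition dual_optimal (R : realType) (d : nat)
    (c : 'rV[R]_d -> 'rV[R]_d -> R) (rho mu : probability (borelV R d) R)
    (phi psi : 'rV[R]_d -> \bar R) : Prop :=
  dual_admissible c rho mu phi psi /\
  forall phi' psi', dual_admissible c rho mu phi' psi' ->
    dual_value rho mu phi' psi' <= dual_value rho mu phi psi.

Definition kantorovich_potentials (R : realType) (d : nat)
    (c : 'rV[R]_d -> 'rV[R]_d -> R) (rho mu : probability (borelV R d) R) :
    set ('rV[R]_d -> \bar R) :=
  [set phi | exists psi, dual_optimal c rho mu phi psi].

(* Elements of Phi may take the value -oo, but only on rho-null sets, so the
   value of -oo - -oo is immaterial. *)
Definition diam_Lq (R : realType) (d : nat) (rho : probability (borelV R d) R)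
    (q : R) (Phi : set ('rV[R]_d -> \bar R)) : \bar R :=
  ereal_sup [set r | exists phi0 phi1, [/\ Phi phi0, Phi phi1 &
    r = ereal_inf (range (fun l : R =>
          Lnorm rho q%:E (fun x => phi0 x - phi1 x - l%:E)))]].

(* Main.v *)
(* Write the potentials as phi = |x|^2 - u, with u Lipschitz because Y is bounded.
   If phi_0 and phi_1 are optimal then at almost every x they admit a common
   approximate subgradient y in Y, so that f = phi_0 - phi_1 satisfies
   |f(x') - f(x)| <= 2 <x' - x, y' - y> up to an arbitrarily small error.
   Join z' to x by N equally spaced points of Omega and replace each of them by a
   point of the support at distance at most delta = d_H(spt rho, Omega).  The sum of
   the gaps telescopes along the segment and is O(|x - z'| / N + N delta); the choice
   N ~ sqrt(|x - z'| / delta) gives |f - l| = O(sqrt(|x - z'| delta) + delta), whose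
   L^q norm is controlled by the moment of order q / 2.
   Existence follows from the direct method for the semi-dual functional
   u |-> int u d rho + int u^* d mu. *)
Require Import Defs.
From HB Require Import structures.
From mathcomp Require Import all_boot all_order all_algebra.
From mathcomp Require Import all_classical all_reals all_analysis.
From mathcomp Require Import measurable_realfun.
From mathcomp Require Import ring lra.
Import Order.TTheory GRing.Theory Num.Theory.
Import numFieldNormedType.Exports.

Set Implicit Arguments.
Unset Strict Implicit.
Unset Printing Implicit Defensive.

Local Open Scope classical_set_scope.
Local Open Scope ring_scope.

(** * Euclidean geometry of row vectors *)

Definition dot (R : realType) (d : nat) (x y : 'rV[R]_d) : R :=
  \sum_(i < d) x ord0 i * y ord0 i.

Lemma dotC (R : realType) d (x y : 'rV[R]_d) : dot x y = dot y x.
Proof. by apply: eq_bigr => i _; rewrite mulrC. Qed.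

Lemma dotDl (R : realType) d (x y z : 'rV[R]_d) :
  dot (x + y) z = dot x z + dot y z.
Proof. by rewrite -big_split; apply: eq_bigr => i _; rewrite mxE mulrDl. Qed.

Lemma dotZl (R : realType) d (a : R) (x z : 'rV[R]_d) :
  dot (a *: x) z = a * dot x z.
Proof. by rewrite mulr_sumr; apply: eq_bigr => i _; rewrite mxE mulrA. Qed.

Lemma dotNl (R : realType) d (x z : 'rV[R]_d) : dot (- x) z = - dot x z.
Proof. by rewrite -scaleN1r dotZl mulN1r. Qed.

Lemma dotBl (R : realType) d (x y z : 'rV[R]_d) :
  dot (x - y) z = dot x z - dot y z.
Proof. by rewrite dotDl dotNl. Qed.

Lemma dotBr (R : realType) d (x y z : 'rV[R]_d) :
  dot z (x - y) = dot z x - dot z y.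
Proof. by rewrite ![dot z _]dotC dotBl. Qed.

Lemma dot_ge0 (R : realType) d (x : 'rV[R]_d) : 0 <= dot x x.
Proof. by apply: sumr_ge0 => i _; rewrite -expr2 sqr_ge0. Qed.

Lemma enorm_ge0 (R : realType) d (x : 'rV[R]_d) : 0 <= enorm x.
Proof. exact: sqrtr_ge0. Qed.

Lemma enormE (R : realType) d (x : 'rV[R]_d) : enorm x = Num.sqrt (dot x x).
Proof. by congr Num.sqrt; apply: eq_bigr => i _; rewrite expr2. Qed.

Lemma sqr_enorm (R : realType) d (x : 'rV[R]_d) : enorm x ^+ 2 = dot x x.
Proof. by rewrite enormE sqr_sqrtr// dot_ge0. Qed.

Lemma sqdistE (R : realType) d (x y : 'rV[R]_d) :
  sqdist x y = enorm x ^+ 2 - 2 * dot x y + enorm y ^+ 2.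
Proof.
rewrite /sqdist !sqr_enorm dotBl !dotBr (dotC y x); ring.
Qed.

Lemma sqdist_ge0 (R : realType) d (x y : 'rV[R]_d) : 0 <= sqdist x y.
Proof. exact: sqr_ge0. Qed.

Lemma dot0l (R : realType) d (x : 'rV[R]_d) : dot 0 x = 0.
Proof. by rewrite -(subrr x) dotBl subrr. Qed.

Lemma enorm_eq0 (R : realType) d (x : 'rV[R]_d) : enorm x = 0 -> x = 0.
Proof.
move=> x0; apply/rowP => i; rewrite mxE; apply/eqP; rewrite -sqrf_eq0.
have /eqP := sqr_enorm x; rewrite x0 expr0n/= eq_sym psumr_eq0.
  by move=> /allP /(_ i); rewrite mem_index_enum expr2 => /(_ isT).
by move=> j _; rewrite -expr2 sqr_ge0.
Qed.

(** Cauchy-Schwarz: with a = |x|, b = |y| and t = x.y, the squared length of b x - a y equals 2ab(ab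
    - t), where a and b are positive once zero vectors are set aside. *)
Lemma dot_le_enorm (R : realType) d (x y : 'rV[R]_d) :
  dot x y <= enorm x * enorm y.
Proof.
have [x0|x0] := eqVneq (enorm x) 0; first by rewrite x0 (enorm_eq0 x0) dot0l mul0r.
have [y0|y0] := eqVneq (enorm y) 0.
  by rewrite y0 (enorm_eq0 y0) dotC dot0l mulr0.
have xp : 0 < enorm x by rewrite lt_neqAle eq_sym x0 enorm_ge0.
have yp : 0 < enorm y by rewrite lt_neqAle eq_sym y0 enorm_ge0.
have := dot_ge0 (enorm y *: x - enorm x *: y).
rewrite dotBl !dotBr !dotZl ![dot _ (_ *: _)]dotC !dotZl -!sqr_enorm (dotC y x).
set a := enorm x in xp *; set b := enorm y in yp *; set t := dot x y.
move=> h; have : 0 <= 2 * (a * b) * (a * b - t) by lra.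
by rewrite pmulr_rge0 ?subr_ge0// mulr_gt0// mulr_gt0.
Qed.

Lemma enormN (R : realType) d (x : 'rV[R]_d) : enorm (- x) = enorm x.
Proof. by rewrite !enormE dotNl dotC dotNl opprK. Qed.

Lemma enorm_distC (R : realType) d (x y : 'rV[R]_d) : enorm (x - y) = enorm (y - x).
Proof. by rewrite -enormN opprB. Qed.

Lemma ler_enormD (R : realType) d (x y : 'rV[R]_d) :
  enorm (x + y) <= enorm x + enorm y.
Proof.
have xy0 : 0 <= enorm x + enorm y by rewrite addr_ge0 ?enorm_ge0.
rewrite -(ler_pXn2r (_ : 0 < 2)%N) ?nnegrE ?enorm_ge0//.
rewrite sqr_enorm dotDl ![dot _ (x + y)]dotC !dotDl -!sqr_enorm (dotC y x).
have := dot_le_enorm x y; lra.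
Qed.

Lemma ler_enormB (R : realType) d (x y : 'rV[R]_d) :
  enorm (x - y) <= enorm x + enorm y.
Proof. by rewrite -(enormN y) ler_enormD. Qed.

Lemma ler_norm_dot (R : realType) d (x y : 'rV[R]_d) :
  `|dot x y| <= enorm x * enorm y.
Proof. by rewrite ler_norml lerNl -dotNl -(enormN x) !dot_le_enorm enormN dot_le_enorm. Qed.

Lemma enorm_le_norm (R : realType) d (x : 'rV[R]_d) : enorm x <= d%:R * `|x|.
Proof.
rewrite -[leRHS]ger0_norm ?mulr_ge0// -sqrtr_sqr ler_wsqrtr//.
apply: (@le_trans _ _ (\sum_(i < d) `|x| ^+ 2)).
  apply: ler_sum => i _; rewrite -[x _ _ ^+ 2]real_normK ?num_real//.
  rewrite ler_pXn2r ?nnegrE//.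
  by rewrite [leRHS]mx_normrE (le_bigmax _ (fun ij : 'I_1 * 'I_d => `|x ij.1 ij.2|) (ord0, i)).
rewrite sumr_const card_ord -[leLHS]mulr_natl exprMn ler_wpM2r ?sqr_ge0//.
by rewrite -natrX ler_nat; case: d x => // d x; rewrite leq_pmulr.
Qed.

Lemma norm_le_enorm (R : realType) d (x : 'rV[R]_d) : `|x| <= enorm x.
Proof.
rewrite [leLHS]mx_normrE; apply/bigmax_leP; split=> [|[i j] _ /=].
  exact: enorm_ge0.
rewrite ord1 -sqrtr_sqr ler_wsqrtr// (bigD1 j)//= lerDl.
by apply: sumr_ge0 => k _; exact: sqr_ge0.
Qed.

(** Bridges the two norms: Lipschitz bounds are Euclidean, while continuity refers to the sup-norm
    topology. *)
Lemma enorm_lipschitz_continuous (R : realType) d (K : R) (u : 'rV[R]_d -> R) :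
  (forall x y, `|u x - u y| <= K * enorm (x - y)) -> continuous u.
Proof.
move=> uK x; apply/(@cvgrPdist_lt _ _ _ _ (nbhs_filter x)) => e e0.
have k0 : 0 < `|K| * d%:R + 1 by rewrite ltr_wpDl// mulr_ge0.
near=> y; apply: le_lt_trans (uK x y) _.
apply: (@le_lt_trans _ _ ((`|K| * d%:R + 1) * `|x - y|)).
  rewrite mulrDl mul1r ler_wpDr// -mulrA.
  apply: (@le_trans _ _ (`|K| * enorm (x - y))).
    by rewrite ler_wpM2r ?enorm_ge0 ?ler_norm.
  by rewrite ler_wpM2l ?enorm_le_norm.
rewrite mulrC -ltr_pdivlMr//; near: y.
apply/nbhs_ballP; exists (e / (`|K| * d%:R + 1)); first exact: divr_gt0.
by move=> y; rewrite -ball_normE.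
Unshelve. all: by end_near. Qed.

Lemma ler_dist_enorm (R : realType) d (x y : 'rV[R]_d) :
  `|enorm x - enorm y| <= enorm (x - y).
Proof.
have := ler_enormD (x - y) y; have := ler_enormD (y - x) x.
by rewrite !subrK (enorm_distC y x) ler_norml; lra.
Qed.

Lemma enorm_continuous (R : realType) d : continuous (@enorm R d).
Proof.
by apply: (@enorm_lipschitz_continuous R d 1) => x y; rewrite mul1r ler_dist_enorm.
Qed.

Lemma dot_continuous (R : realType) d (y : 'rV[R]_d) : continuous (fun x => dot x y).
Proof.
apply: (@enorm_lipschitz_continuous R d (enorm y)) => x z.
by rewrite -dotBl mulrC ler_norm_dot.
Qed.

(** The lower bound 1 keeps [K] positive even when [Y] is empty or reduced to the origin; the final
    constant and the tolerance [r * K] rely on this. *)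
Lemma compact_enorm_bounded (R : realType) d (Y : set 'rV[R]_d) : compact Y ->
  exists2 K : R, 1 <= K & forall y, Y y -> enorm y <= K.
Proof.
move=> /compact_bounded[N [_ NY]].
exists (1 + d%:R * `|N + 1|); first by rewrite lerDl mulr_ge0.
move=> y Yy; apply: le_trans (enorm_le_norm y) _.
rewrite ler_wpDl// ler_wpM2l//.
by apply: le_trans (NY (N + 1) _ y Yy) (ler_norm _); rewrite ltrDl.
Qed.

Lemma enorm_dense_sequence (R : realType) d :
  exists s : nat -> 'rV[R]_d, forall x e, 0 < e -> exists j, enorm (x - s j) < e.
Proof.
pose f (q : 'rV[rat]_d) : 'rV[R]_d := map_mx ratr q.
exists (fun j => if unpickle j is Some q then f q else 0) => x e e0.
(* Dividing by d + 1 covers d = 0 and makes d * t strictly less than e. *)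
have : 0 < e / d.+1%:R by rewrite divr_gt0.
set t := e / d.+1%:R => t0.
have /choice[q qx] : forall i : 'I_d, exists r : rat, `|x ord0 i - ratr r| < t.
  move=> i; have : x ord0 i < x ord0 i + t by rewrite ltrDl.
  move=> /rat_in_itvoo[r]; rewrite in_itv/= => /andP[? ?].
  by exists r; rewrite ltr_norml; lra.
exists (pickle (\row_i q i)); rewrite pickleK.
apply: le_lt_trans (enorm_le_norm _) _.
apply: (@le_lt_trans _ _ (d%:R * t)).
  rewrite ler_wpM2l// [leLHS]mx_normrE; apply/bigmax_leP; split.
    exact: ltW.
  by move=> [i j] _ /=; rewrite ord1 !mxE ltW.
by rewrite /t mulrA ltr_pdivrMr// mulrC ltr_pM2l// ltr_nat.
Qed.

Lemma open_enorm_ball (R : realType) d (x : 'rV[R]_d) (e : R) :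
  open [set y | enorm (y - x) < e].
Proof.
rewrite (_ : mkset _ = (fun y => enorm (y - x)) @^-1` [set r | r < e])//.
apply: open_comp; last exact: open_lt.
move=> y _; apply: (@enorm_lipschitz_continuous R d 1) => a b.
by rewrite mul1r (le_trans (ler_dist_enorm _ _))// opprB addrA subrK.
Qed.

(** * Borel measurability and the support of a measure *)

Section borel.
Context (R : realType) (d : nat).
Implicit Types rho : probability (borelV R d) R.

Lemma borelV_open (U : set 'rV[R]_d) : open U -> measurable (U : set (borelV R d)).
Proof. by move=> oU; apply: sub_sigma_algebra. Qed.

Lemma borelV_compact (Y : set 'rV[R]_d) : compact Y ->
  measurable (Y : set (borelV R d)).
Proof.
move=> cY; rewrite -(setCK Y); apply: measurableC; apply: borelV_open.
by apply: closed_openC; apply: compact_closed => //; exact: norm_hausdorff.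
Qed.

Lemma borelV_measurable_lsc (f : 'rV[R]_d -> \bar R) :
  (forall a : R, open [set x | (a%:E < f x)%E]) ->
  measurable_fun (setT : set (borelV R d)) f.
Proof.
move=> fo; apply: (measurability _ (ErealGenOInfty.measurableE R)).
move=> /= _ [_ [a ->]] <-; apply: measurableI => //; apply: borelV_open.
rewrite (_ : _ @^-1` _ = [set x | (a%:E < f x)%E])//.
by apply/seteqP; split => x /=; rewrite in_itv/= andbT.
Qed.

Lemma borelV_measurable_cont (f : 'rV[R]_d -> R) : continuous f ->
  measurable_fun (setT : set (borelV R d)) f.
Proof.
move=> fc; apply/measurable_EFinP; apply: borelV_measurable_lsc => a.
rewrite (_ : mkset _ = f @^-1` [set r | a < r]); last first.
  by apply/seteqP; split => x /=; rewrite lte_fin.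
by apply: open_comp => //; exact: open_gt.
Qed.

(** Lindelof argument: every point outside the support lies in a null ball with centre [s j] and
    radius 1/(n+1), and there are countably many such balls. *)
Lemma ae_spt rho : {ae rho, forall x, spt rho x}.
Proof.
have [s sd] := enorm_dense_sequence R d.
pose B j n := [set y | enorm (y - s j) < n.+1%:R^-1].
pose F j n := if `[< rho (B j n) = 0%E >] then B j n else set0.
suff : rho.-negligible (~` spt rho) by [].
apply: (@negligibleS _ _ _ rho (\bigcup_j \bigcup_n F j n)); last first.
  do 2 apply: negligible_bigcup => ?; rewrite /F; case: asboolP => [r0|_].
    apply/negligibleP => //; apply: borelV_open; exact: open_enorm_ball.
  exact: negligible_set0.
move=> x /existsNP[U /not_implyP[oU /not_implyP[Ux]]].
move=> /negP; rewrite -leNgt => rU.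
have /nbhs_ballP[e /= e0 eU] : nbhs x U by exact: open_nbhs_nbhs.
(* Radius 1/(n+1) < e/2 ensures that [B j n], once it contains x, lies in the ball of radius e about
   x, hence in the null set [U]. *)
have /ltr_add_invr[n] : 0 < e / 2 by rewrite divr_gt0.
rewrite add0r => ne.
have [|j xj] := sd x n.+1%:R^-1; first by rewrite invr_gt0.
exists j => //; exists n => //; rewrite /F.
case: asboolP => // rB; exfalso; apply: rB; apply/eqP.
rewrite eq_le measure_ge0 andbT (le_trans _ rU)// le_measure ?inE//.
- by apply: borelV_open; exact: open_enorm_ball.
- exact: borelV_open.
move=> y By; apply: eU; rewrite -ball_normE/=.
apply: le_lt_trans (norm_le_enorm _) _.
have := ler_enormD (x - s j) (s j - y); rewrite addrA subrK => /le_lt_trans; apply.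
move: By xj ne; rewrite /B/= (enorm_distC (s j)).
move: (n.+1%:R^-1) => t; lra.
Qed.
End borel.

(* The conjugate form of the c-transform: with [phi x = |x|^2 - u x],
   [u x] is the supremum of [2 x.y - |y|^2 + psi y] over [y] in [Y]. *)
Lemma c_transform_on (R : realType) d (K : R) (Y : set 'rV[R]_d)
    (phi psi : 'rV[R]_d -> \bar R) (x0 y0 : 'rV[R]_d) :
  (forall y, Y y -> enorm y <= K) ->
  (forall x, phi x != +oo%E) -> (forall y, psi y != +oo%E) ->
  phi x0 \is a fin_num -> Y y0 -> psi y0 \is a fin_num ->
  (forall x y, phi x + psi y <= (sqdist x y)%:E)%E ->
  exists u : 'rV[R]_d -> R,
  [/\ forall x x', `|u x - u x'| <= 2 * K * enorm (x - x'),
      forall x, (phi x <= (enorm x ^+ 2 - u x)%:E)%E,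
      forall x y, Y y -> (psi y <= (enorm y ^+ 2 - (2 * dot x y - u x))%:E)%E &
      forall x e, 0 < e -> exists y,
        [/\ Y y, psi y \is a fin_num &
            sqdist x y <= enorm x ^+ 2 - u x + fine (psi y) + e]].
Proof.
move=> YK phioo psioo phix0 Yy0 psiy0 adm.
(* Only points where [psi] is finite enter the supremum, which makes it a supremum of real
   numbers. *)
pose D := [set y | Y y /\ psi y \is a fin_num].
pose v x y : R := 2 * dot x y - enorm y ^+ 2 + fine (psi y).
pose S x := [set v x y | y in D].
have S0 x : S x !=set0 by exists (v x y0); exists y0.
have vlip x x' y : Y y -> v x y <= v x' y + 2 * K * enorm (x - x').
  move=> Yy; have : dot (x - x') y <= K * enorm (x - x').
    apply: le_trans (dot_le_enorm _ _) _; rewrite mulrC ler_wpM2r ?enorm_ge0//.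
    exact: YK.
  by rewrite /v dotBl; lra.
(* Admissibility bounds the family at [x0], where [phi] is finite; the Lipschitz estimate carries
   the bound to every other x. *)
have Sub x : has_ubound (S x).
  exists (enorm x0 ^+ 2 - fine (phi x0) + 2 * K * enorm (x - x0)) => _ [y [Yy fy] <-].
  apply: le_trans (vlip x x0 y Yy) _; rewrite lerD2r /v.
  have := adm x0 y; rewrite -(fineK phix0) -(fineK fy) lee_fin sqdistE; lra.
have Ssup x : has_sup (S x) by split.
have vu x y : D y -> v x y <= sup (S x).
  by move=> Dy; apply: ub_le_sup => //; exists y.
have ulip x x' : sup (S x) <= sup (S x') + 2 * K * enorm (x - x').
  apply: ge_sup => // _ [y Dy <-]; apply: le_trans (vlip x x' y Dy.1) _.
  by rewrite lerD2r vu.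
exists (fun x => sup (S x)); split.
- move=> x x'; rewrite ler_norml; have := ulip x x'; have := ulip x' x.
  rewrite (enorm_distC x' x); lra.
- move=> x; have := phioo x; case E : (phi x) => [r| |]// _; last exact: leNye.
  rewrite lee_fin lerBrDl -lerBrDr; apply: ge_sup => // _ [y [Yy fy] <-].
  by have := adm x y; rewrite E -(fineK fy) lee_fin sqdistE /v; lra.
- move=> x y Yy; have := psioo y; case E : (psi y) => [r| |]// _; last exact: leNye.
  have : v x y <= sup (S x) by apply: vu; split => //; rewrite E.
  by rewrite /v E/= lee_fin; lra.
- move=> x e e0; have [_ [y [Yy fy] <-] h] := sup_adherent e0 (Ssup x).
  exists y; split => //; rewrite sqdistE; rewrite /v in h; lra.
Qed.

(* Tychonoff on a dense sequence, then equicontinuity. *)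
Lemma lipschitz_sequence_compact (R : realType) d (L : R) (U : nat -> 'rV[R]_d -> R) :
  (forall n x y, `|U n x - U n y| <= L * enorm (x - y)) -> (forall n, U n 0 = 0) ->
  exists (h : nat -> nat) (u : 'rV[R]_d -> R),
    (forall k, (k <= h k)%N) /\ forall x, U (h k) x @[k --> \oo] --> u x.
Proof.
move=> UL U0; have [s sd] := enorm_dense_sequence R d.
pose A (j : nat) : set R := `[- (L * enorm (s j)), L * enorm (s j)]%classic.
have cA := @tychonoff nat (fun=> R) A (fun j => @segment_compact _ _ _).
pose v n : prod_topology (fun _ : nat => R) := fun j => U n (s j).
have vA n : forall j, A j (v n j).
  move=> j; rewrite /A /v /= in_itv/= -ler_norml.
  by have := UL n (s j) 0; rewrite U0 !subr0.
have [|p [_ pcl]] := cA (v @ \oo) _; first by exists 0 => // n _; exact: vA.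
(* [p] is a mere cluster point in the product topology, so indices are chosen one k at a time,
   controlling the first k coordinates. A possibly non-monotone [h] with [k <= h k] serves as the
   subsequence. *)
have /choice[h hP] : forall k, exists n, (k <= n)%N /\
    forall j, (j < k)%N -> `|p j - U n (s j)| < k.+1%:R^-1.
  move=> k.
  have nA : (v @ \oo) [set f | exists2 n, (k <= n)%N & f = v n].
    by exists k => // n kn; exists n.
  have nB : nbhs p [set f | forall j, (j < k)%N -> `|p j - f j| < k.+1%:R^-1].
    (* Induction on the number of constrained coordinates alone; the radius stays fixed. *)
    elim: {1}k => [|m IHm]; first by apply: filterE => f j; rewrite ltn0.
    have nm : nbhs p [set f : prod_topology (fun _ : nat => R) | `|p m - f m| < k.+1%:R^-1].
      have nR : nbhs (p m : R) [set r : R | `|p m - r| < k.+1%:R^-1].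
        apply/nbhs_ballP; exists k.+1%:R^-1; first by rewrite /= invr_gt0.
        by move=> r; rewrite -ball_normE.
      exact: (@proj_continuous nat (fun=> R) m p _ nR).
    apply: filterS2 IHm nm => f fm fk j; rewrite ltnS leq_eqVlt => /predU1P[->//|].
    exact: fm.
  have [_ [[n kn ->] vB]] := pcl _ _ nA nB.
  by exists n.
have hs j : U (h k) (s j) @[k --> \oo] --> p j.
  apply/cvgrPdist_lt => e e0.
  have /ltr_add_invr[n] := e0; rewrite add0r => ne.
  exists (maxn j.+1 n) => // k /=; rewrite geq_max => /andP[jk nk].
  apply: lt_trans ((hP k).2 j jk) _; apply: le_lt_trans ne.
  by rewrite lef_pV2 ?posrE// ler_nat ltnS.
have uc x : cvg (U (h k) x @[k --> \oo]).
  apply: cauchy_cvg; apply: cauchy_exP => e e0.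
  have L0 : 0 < `|L| + 1 by rewrite ltr_wpDl.
  (* One half of e pays for moving from x to [s j] by the Lipschitz bound, the other for the
     convergence at [s j]. *)
  have [|j xj] := sd x (e / 2 / (`|L| + 1)); first by rewrite !divr_gt0.
  exists (p j).
  have e20 : 0 < e / 2 by rewrite divr_gt0.
  have /cvgrPdist_lt/(_ _ e20) := hs j.
  apply: filterS => k; rewrite -ball_normE/= => hk.
  rewrite (splitr e) -(subrKA (U (h k) (s j))) (le_lt_trans (ler_normD _ _))// ltrD//.
  apply: le_lt_trans (UL _ _ _) _; rewrite enorm_distC.
  move: xj; rewrite ltr_pdivlMr// mulrC; apply: le_lt_trans.
  by rewrite ler_wpM2r ?enorm_ge0// (le_trans (ler_norm L))// lerDl.
exists h, (fun x => lim (U (h k) x @[k --> \oo])); split => [k|x]; first by case: (hP k).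
exact: uc.
Qed.

(** * Semi-dual problem *)

Lemma le_limn_einf (R : realType) (a b : (\bar R)^nat) :
  (forall n, a n <= b n)%E -> (limn_einf a <= limn_einf b)%E.
Proof.
move=> ab; rewrite !limn_einf_lim; apply: lee_lim; do ?exact: is_cvg_einfs.
apply: nearW => n; apply: le_ereal_inf_tmp => _ [k /= nk <-].
by apply: le_trans (ab k); apply: ereal_inf_lbound; exists k.
Qed.

(* Twice the Legendre transform of [u / 2]; for [c = sqdist] the c-transform of
   [|x|^2 - u] is [|y|^2 - conjugate u]. *)
Definition conjugate (R : realType) d (u : 'rV[R]_d -> R) (y : 'rV[R]_d) : \bar R :=
  ereal_sup (range (fun x => (2 * dot x y - u x)%:E)).

Lemma conjugate_ub (R : realType) d (u : 'rV[R]_d -> R) x y :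
  ((2 * dot x y - u x)%:E <= conjugate u y)%E.
Proof. by apply: ereal_sup_ubound; exists x. Qed.

Lemma conjugate_ge0 (R : realType) d (u : 'rV[R]_d -> R) y :
  u 0 = 0 -> (0 <= conjugate u y)%E.
Proof. by move=> u0; have := conjugate_ub u 0 y; rewrite dot0l u0 mulr0 subr0. Qed.

(** A supremum of functions continuous in y is lower semicontinuous: its superlevel sets are unions
    of open sets. *)
Lemma conjugate_measurable (R : realType) d (u : 'rV[R]_d -> R) :
  measurable_fun (setT : set (borelV R d)) (conjugate u).
Proof.
apply: borelV_measurable_lsc => a.
rewrite (_ : mkset _ = \bigcup_x [set y | a < 2 * dot x y - u x]).
  apply: bigcup_open => x _.
  rewrite (_ : mkset _ = (fun y => dot y x) @^-1` [set r | (a + u x) / 2 < r]).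
    by apply: open_comp; [move=> y _; exact: dot_continuous|exact: open_gt].
  apply/seteqP; split => y /=; rewrite dotC; lra.
apply/seteqP; split => y /=.
  by move=> /ereal_sup_gt[_ [x _ <-]]; rewrite lte_fin => h; exists x.
by move=> [x _ h]; apply: lt_le_trans (conjugate_ub u x y); rewrite lte_fin.
Qed.

Lemma measurable_sqr_enorm (R : realType) d :
  measurable_fun (setT : set (borelV R d)) (fun x : 'rV[R]_d => (enorm x ^+ 2)%:E).
Proof.
apply/measurable_EFinP; apply: borelV_measurable_cont => x.
by apply: (@cvgM _ _ _ (nbhs_filter x)); exact: enorm_continuous.
Qed.

(** * Integrability under a finite second moment *)

Section integrability.
Context (R : realType) (d : nat) (rho : probability (borelV R d) R).
Hypothesis rho2 : finite_second_moment rho.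

Lemma integrable_quadratic (a b : R) :
  rho.-integrable setT (fun x : borelV R d => (a * enorm (x : 'rV[R]_d) ^+ 2 + b)%:E).
Proof.
have m2 := @measurable_sqr_enorm R d.
have i2 : rho.-integrable setT (fun x : borelV R d => (enorm (x : 'rV[R]_d) ^+ 2)%:E).
  apply/integrableP; split => //.
  by under eq_integral do rewrite gee0_abs ?lee_fin ?sqr_ge0//.
have := integrableD measurableT (integrableZl measurableT a i2)
  (finite_measure_integrable_cst rho b measurableT).
exact: eq_integrable.
Qed.

(** The growth of [u] is at most linear, and |x| <= |x|^2 + 1 turns this into a quadratic
    majorant. *)
Lemma integrable_lipschitz (L : R) (u : 'rV[R]_d -> R) :
  (forall x y, `|u x - u y| <= L * enorm (x - y)) ->
  rho.-integrable setT (fun x : borelV R d => (u x)%:E).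
Proof.
move=> uL; apply: le_integrable (integrable_quadratic `|L| (`|L| + `|u 0|)) => //.
  apply/measurable_EFinP; apply: borelV_measurable_cont.
  exact: enorm_lipschitz_continuous uL.
move=> x _; rewrite !abse_EFin lee_fin.
have x0 := enorm_ge0 (x : 'rV[R]_d).
apply: le_trans (ler_norm _); rewrite -[u x](subrK (u 0)).
apply: le_trans (ler_normD _ _) _; rewrite addrA lerD2r.
apply: le_trans (uL _ _) _; rewrite subr0.
apply: (@le_trans _ _ (`|L| * enorm (x : 'rV[R]_d))).
  by rewrite ler_wpM2r ?ler_norm.
by rewrite -[X in _ + X]mulr1 -mulrDr ler_wpM2l//; nra.
Qed.

End integrability.

(* Compactness of normalised Lipschitz functions gives a pointwise limit of a
   minimising sequence; the first integral converges by domination and the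
   second is lower semicontinuous by Fatou. *)
Lemma semidual_minimizer (R : realType) d (L : R)
    (rho mu : probability (borelV R d) R) (w : 'rV[R]_d -> R) :
  finite_second_moment rho ->
  let lip := fun u : 'rV[R]_d -> R =>
    (forall x y, `|u x - u y| <= L * enorm (x - y)) /\ u 0 = 0 in
  let I := fun u : 'rV[R]_d -> R =>
    (\int[rho]_x (u x)%:E + \int[mu]_y conjugate u y)%E in
  lip w -> (I w < +oo)%E ->
  exists2 u, lip u & forall v, lip v -> (I u <= I v)%E.
Proof.
move=> rho2 lip I lipw Iw.
have lint v : lip v -> rho.-integrable setT (fun x : borelV R d => (v x)%:E).
  by move=> [vL _]; exact: integrable_lipschitz vL.
have Lint : rho.-integrable setT (fun x : borelV R d => (L * enorm (x : 'rV[R]_d))%:E).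
  apply: (@integrable_lipschitz _ _ _ rho2 `|L|) => x y.
  by rewrite -mulrBr normrM ler_wpM2l// ler_dist_enorm.
have lbnd v x : lip v -> `|v x| <= L * enorm x.
  by move=> [vL v0]; have := vL x 0; rewrite v0 !subr0.
have cj0 v : lip v -> (0 <= \int[mu]_y conjugate v y)%E.
  by move=> [_ v0]; apply: integral_ge0 => y _; exact: conjugate_ge0.
(* Conjugates are nonnegative because of the normalisation at 0, so bounding the first integral from
   below suffices to keep the infimum above -oo. *)
have Ilb v : lip v -> (- (\int[rho]_x (L * enorm (x : 'rV[R]_d))%:E) <= I v)%E.
  move=> lv; rewrite /I -[leLHS]adde0; apply: leeD; last exact: cj0.
  rewrite leeNl -integralN/=; last exact: integrable_add_def (lint v lv).
  apply: le_integral => //; first exact: integrableN (lint v lv).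
  move=> x _; rewrite -?EFinN lee_fin; apply: le_trans (lbnd v x lv).
  by rewrite -normrN ler_norm.
pose m := ereal_inf [set I v | v in lip].
have mfin : m \is a fin_num.
  rewrite fin_numE; apply/andP; split.
    rewrite -ltNye (@lt_le_trans _ _ (- (\int[rho]_x (L * enorm (x : 'rV[R]_d))%:E))%E)//.
      by rewrite ltNye_eq fin_numN integrable_fin_num.
    by apply: le_ereal_inf_tmp => _ [v lv <-]; exact: Ilb.
  by rewrite -ltey; apply: le_lt_trans Iw; apply: ereal_inf_lbound; exists w.
have /choice[U UP] : forall n : nat, exists v, lip v /\ (I v < m + n.+1%:R^-1%:E)%E.
  move=> n; have [|_ [v lv <-] h] := @lb_ereal_inf_adherent _ _ n.+1%:R^-1 _ mfin.
    by rewrite invr_gt0.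
  by exists v.
have [h [u [kh Uu]]] := lipschitz_sequence_compact (fun n => (UP n).1.1)
   (fun n => (UP n).1.2).
have lu : lip u.
  split=> [x y|].
    have Uxy : (fun k => `|U (h k) x - U (h k) y|) @ \oo --> `|u x - u y|.
      by apply: cvg_norm; apply: cvgB; exact: Uu.
    rewrite -(cvg_lim _ Uxy)//; apply: limr_le; first exact: cvgP Uxy.
    by apply: nearW => k; exact: (UP (h k)).1.1.
  have := Uu 0; under eq_fun do rewrite (UP (h _)).1.2.
  by move=> /(cvg_unique _ (cvg_cst _)) ->.
exists u => // v lv; apply: (@le_trans _ _ m); last first.
  by apply: ereal_inf_lbound; exists v.
have [|||||_ _ cvgint] := @dominated_convergence _ _ _ rho _ measurableT
    (fun k x => (U (h k) x)%:E) (fun x => (u x)%:E)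
    (fun x => (L * enorm (x : 'rV[R]_d))%:E).
- by move=> n; case/integrableP : (lint _ (UP (h n)).1).
- by case/integrableP : (lint _ lu).
- by apply: aeW => x _; apply: cvg_EFin; [exact: nearW|exact: Uu].
- exact: Lint.
- by apply: aeW => x n _; rewrite abse_EFin lee_fin; exact: lbnd (UP (h n)).1.
have fat : (\int[mu]_y conjugate u y <= limn_einf (fun k => \int[mu]_y conjugate (U (h k)) y))%E.
  apply: le_trans (@fatou _ _ _ mu _ measurableT (fun k => conjugate (U (h k))) _ _); first last.
  - by move=> n y _; apply: conjugate_ge0; exact: (UP (h n)).1.2.
  - by move=> n; exact: conjugate_measurable.
  apply: ge0_le_integral => //.
  - by move=> y _; apply: conjugate_ge0; exact: lu.2.
  - exact: conjugate_measurable.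
  - apply: (@emeasurable_fun_cvg _ (borelV R d) _ setT
      (fun n (y : borelV R d) => einfs (fun k => conjugate (U (h k)) y) n)).
      by apply: measurable_fun_einfs => n; exact: conjugate_measurable.
    by move=> y _; rewrite limn_einf_lim; exact: is_cvg_einfs.
  (* Each affine form in the supremum defining [conjugate u] is the limit of the corresponding forms
     of [U (h k)], which lie below their conjugates. *)
  move=> y _; apply: ge_ereal_sup => _ [x _ <-].
  have c : (fun k => (2 * dot x y - U (h k) x)%:E) @ \oo --> (2 * dot x y - u x)%:E.
    by apply: cvg_EFin; [exact: nearW|apply: cvgB; [exact: cvg_cst|exact: Uu]].
  rewrite -(cvg_limn_einf_sup c).1; apply: le_limn_einf => k; exact: conjugate_ub.
have intfin v' : lip v' -> (\int[rho]_x (v' x)%:E)%E \is a fin_num.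
  by move=> lv'; apply: integrable_fin_num => //; exact: lint.
(* Near-minimality and [k <= h k] bound the second integral of [U (h k)] by m + 1/(k+1) minus the
   first; this bound converges. *)
have hc : (fun k => m + (k.+1%:R^-1)%:E - \int[rho]_x (U (h k) x)%:E)%E @ \oo -->
    (m + 0 - \int[rho]_x (u x)%:E)%E.
  apply: cvgeB => //; first by rewrite adde0 fin_num_adde_defr.
  apply: cvgeD => //; first by rewrite fin_num_adde_defr.
    exact: cvg_cst.
  apply: cvg_EFin; first exact: nearW.
  exact: cvg_harmonic.
rewrite /I addeC -leeBrDr ?intfin//.
apply: (le_trans fat); rewrite adde0 in hc; rewrite -(cvg_limn_einf_sup hc).1.
apply: le_limn_einf => k; have := ltW (UP (h k)).2.
rewrite /I addeC leeBrDr ?(intfin _ (UP (h k)).1)//; move=> /le_trans; apply.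
by rewrite leeD2l// lee_fin lef_pV2 ?posrE// ler_nat ltnS.
Qed.

(** * Almost-everywhere statements for probabilities *)

Lemma ae_exists (d : measure_display) (T : measurableType d) (R : realType)
    (P : probability T R) (Q : T -> Prop) :
  {ae P, forall x, Q x} -> exists x, Q x.
Proof.
move=> [N [mN N0 QN]]; apply: contrapT => /forallNP nQ.
have : P setT = 0%E.
  apply/eqP; rewrite eq_le measure_ge0 andbT -N0 le_measure ?inE//.
  by move=> x _; apply: QN; exact: nQ.
by rewrite probability_setT => /eqP; rewrite onee_eq0.
Qed.

Lemma ae_imply (d : measure_display) (T : measurableType d) (R : realType)
    (P : probability T R) (Q1 Q2 : T -> Prop) :
  (forall x, Q1 x -> Q2 x) -> {ae P, forall x, Q1 x} -> {ae P, forall x, Q2 x}.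
Proof. exact: filterS. Qed.

Lemma ae_imply2 (d : measure_display) (T : measurableType d) (R : realType)
    (P : probability T R) (Q1 Q2 Q3 : T -> Prop) :
  (forall x, Q1 x -> Q2 x -> Q3 x) -> {ae P, forall x, Q1 x} ->
  {ae P, forall x, Q2 x} -> {ae P, forall x, Q3 x}.
Proof. exact: filterS2. Qed.

Lemma integral_cst_probability (d : measure_display) (T : measurableType d)
    (R : realType) (P : probability T R) (r : R) : (\int[P]_x r%:E = r%:E)%E.
Proof. by rewrite integral_cst//= probability_setT mule1. Qed.

(** * Existence of potentials and almost-touching points *)

Section compactly_supported.
Context (R : realType) (d : nat) (rho mu : probability (borelV R d) R).
Context (Y : set 'rV[R]_d) (K : R).
Hypotheses (rho2 : finite_second_moment rho) (compactY : compact Y).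
Hypotheses (YK : forall y, Y y -> enorm y <= K) (muY : mu Y = 1%E).

Lemma ae_in_compact : {ae mu, forall y, Y y}.
Proof.
have mY := borelV_compact compactY.
exists (~` Y); split => //; first exact: measurableC.
by rewrite probability_setC// muY subee.
Qed.

Lemma compact_second_moment : finite_second_moment mu.
Proof.
have m2 := @measurable_sqr_enorm R d.
apply: (@le_lt_trans _ _ (\int[mu]_x (K ^+ 2)%:E)%E); last first.
  by rewrite integral_cst_probability ltry.
apply: ae_ge0_le_integral => //.
- by move=> x _; rewrite lee_fin sqr_ge0.
- by move=> x _; rewrite lee_fin sqr_ge0.
apply: ae_imply _ ae_in_compact => y Yy _; rewrite lee_fin.
have := YK Yy; have := enorm_ge0 y; nra.
Qed.

Local Notation lip u := (forall x y, `|u x - u y| <= 2 * K * enorm (x - y)).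

Lemma int_enorm2_fin (nu : probability (borelV R d) R) : finite_second_moment nu ->
  nu.-integrable setT (fun x : borelV R d => (enorm (x : 'rV[R]_d) ^+ 2)%:E).
Proof.
move=> nu2; have := @integrable_quadratic _ _ _ nu2 1 0.
by apply: eq_integrable => // x _; rewrite mul1r addr0.
Qed.

(** Admissibility is the Fenchel-Young inequality. Splitting the integrals reduces later comparisons
    of dual values to linear arithmetic. *)
Lemma semidual_pair (u : 'rV[R]_d -> R) : lip u -> u 0 = 0 ->
  (\int[mu]_y conjugate u y < +oo)%E ->
  let phi := fun x => (enorm x ^+ 2 - u x)%:E in
  let psi := fun y => ((enorm y ^+ 2)%:E - conjugate u y)%E in
  [/\ dual_admissible (@sqdist R d) rho mu phi psi,
     (\int[rho]_x phi x = \int[rho]_x (enorm x ^+ 2)%:E - \int[rho]_x (u x)%:E)%E &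
     (\int[mu]_y psi y = \int[mu]_y (enorm y ^+ 2)%:E - \int[mu]_y conjugate u y)%E].
Proof.
move=> ul u0 cu phi psi.
have ic : mu.-integrable setT (conjugate u : borelV R d -> \bar R).
  apply/integrableP; split; first exact: conjugate_measurable.
  by under eq_integral do rewrite gee0_abs ?conjugate_ge0//.
have iu := integrable_lipschitz rho2 ul.
have ir := int_enorm2_fin rho2.
have im := int_enorm2_fin compact_second_moment.
have iphi := integrableB measurableT ir iu.
have ipsi := integrableB measurableT im ic.
split; first split.
- split => // y; rewrite /psi; have := conjugate_ge0 y u0.
  by case: (conjugate u y).
- exact: eq_integrable iphi.
- exact: ipsi.
- move=> x y; rewrite /phi /psi; have := conjugate_ub u x y.
  case: (conjugate u y) => [r| |]//=.
    by rewrite !lee_fin sqdistE; lra.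
  by move=> _; rewrite leNye.
- by rewrite -(integralB measurableT ir iu).
- by rewrite -(integralB measurableT im ic).
Qed.

(** The pair (|x|^2 - u - k, |y|^2 - [conjugate u] + k) dominates the given one: pointwise against
    [phi], in the integral against [psi]. Here k is the value at 0 of the c-transform function,
    subtracted to normalise [u]; the almost-touching points come from the supremum defining it. *)
Lemma semidual_improvement (phi psi : 'rV[R]_d -> \bar R) :
  dual_admissible (@sqdist R d) rho mu phi psi ->
  exists (u : 'rV[R]_d -> R) (k : R),
  [/\ lip u /\ u 0 = 0,
    (\int[mu]_y conjugate u y < +oo)%E /\
    (\int[mu]_y conjugate u y + \int[mu]_y psi y <=
      \int[mu]_y (enorm y ^+ 2)%:E + k%:E)%E,
    forall x, (phi x <= (enorm x ^+ 2 - u x - k)%:E)%E &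
    forall x e, 0 < e -> exists y, [/\ Y y, psi y \is a fin_num &
      sqdist x y <= enorm x ^+ 2 - u x - k + fine (psi y) + e]].
Proof.
move=> [[phioo psioo] iphi ipsi adm].
have [x0 phix0] : exists x, phi x \is a fin_num.
  apply: (@ae_exists _ (borelV R d) _ rho).
  by apply: ae_imply _ (integrable_ae measurableT iphi) => x; exact.
have [y0 [Yy0 psiy0]] : exists y, Y y /\ psi y \is a fin_num.
  apply: (@ae_exists _ (borelV R d) _ mu).
  by apply: ae_imply2 _ ae_in_compact (integrable_ae measurableT ipsi) => y Yy /(_ I).
have [w [wl wphi wpsi wapp]] := c_transform_on YK phioo psioo phix0 Yy0 psiy0 adm.
pose u x := w x - w 0.
have u0 : u 0 = 0 by rewrite /u subrr.
have im := int_enorm2_fin compact_second_moment.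
pose g y := ((enorm (y : 'rV[R]_d) ^+ 2)%:E + (w 0)%:E - psi y)%E.
have ik := finite_measure_integrable_cst mu (w 0) measurableT.
have ig0 := integrableD measurableT im ik.
have ig : mu.-integrable setT (g : borelV R d -> \bar R).
  exact: (integrableB measurableT ig0 ipsi).
have cg y : Y y -> (conjugate u y <= g y)%E.
  move=> Yy; apply: ge_ereal_sup => _ [x _ <-]; rewrite /g.
  have := wpsi x y Yy; have := psioo y; case: (psi y) => [r| |]//= _.
    by rewrite /u !lee_fin; lra.
  by rewrite addey// leey.
(* [g] is known to be nonnegative on [Y] only, that is almost surely; its absolute value meets the
   pointwise sign condition for monotonicity of the integral. *)
have aeg : ae_eq mu setT (g : borelV R d -> \bar R) (fun y => `|g y|%E).
  apply: ae_imply _ ae_in_compact => y Yy _; rewrite gee0_abs//.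
  exact: le_trans (conjugate_ge0 y u0) (cg y Yy).
have mg : measurable_fun setT (g : borelV R d -> \bar R) by case/integrableP: ig.
have mag : measurable_fun setT (fun y : borelV R d => `|g y|%E) by apply: measurableT_comp.
have cug : (\int[mu]_y conjugate u y <= \int[mu]_y `|g y|)%E.
  apply: ae_ge0_le_integral => //.
  - by move=> y _; exact: conjugate_ge0.
  - exact: conjugate_measurable.
  by apply: ae_imply _ ae_in_compact => y Yy _; exact: le_trans (cg y Yy) (lee_abs _).
exists u, (w 0); split.
- by split => // x y; rewrite /u opprB addrA subrK; exact: wl.
- split.
    by apply: le_lt_trans cug _; case/integrableP: ig.
  move: cug; rewrite -(ae_eq_integral _ _ _ _ _ aeg)// /g.
  rewrite (integralB measurableT ig0 ipsi) (integralD measurableT im ik).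
  by rewrite integral_cst_probability leeBrDr ?integrable_fin_num.
- by move=> x; apply: le_trans (wphi x) _; rewrite lee_fin /u; lra.
- move=> x e e0; have [y [Yy fy xy]] := wapp x e e0; exists y; split => //.
  by rewrite /u; lra.
Qed.

(** The dual value of the pair built from a minimiser [u] is the sum of the second moments minus the
    semi-dual functional at [u]. A competitor is first improved to such a pair, up to constants [k]
    that cancel. *)
Lemma kantorovich_potentials_nonempty :
  kantorovich_potentials (@sqdist R d) rho mu !=set0.
Proof.
(* The zero pair is admissible since the cost is nonnegative; improving it gives [w] with finite
   semi-dual functional, which starts the minimisation. *)
have adm0 : dual_admissible (@sqdist R d) rho mu (cst 0%E) (cst 0%E).
  split; [by []|exact: integrable0|exact: integrable0|].
  by move=> x y; rewrite adde0 lee_fin sqdist_ge0.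
have [w [_ [lw [cw _] _ _]]] := semidual_improvement adm0.
have ifin u : lip u -> (\int[rho]_x (u x)%:E)%E \is a fin_num.
  by move=> ul; apply: integrable_fin_num => //; exact: integrable_lipschitz ul.
have Iw : (\int[rho]_x (w x)%:E + \int[mu]_y conjugate w y < +oo)%E.
  by apply: lte_add_pinfty => //; rewrite ltey_eq ifin//; exact: lw.1.
have [u [ul u0] umin] := semidual_minimizer rho2 lw Iw.
have cu : (\int[mu]_y conjugate u y < +oo)%E.
  have := le_lt_trans (umin w lw) Iw; rewrite -(fineK (ifin u ul)).
  by case: (\int[mu]_y conjugate u y)%E => [r| |]; rewrite ?ltry.
have cfin v : v 0 = 0 -> (\int[mu]_y conjugate v y < +oo)%E ->
    (\int[mu]_y conjugate v y)%E \is a fin_num.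
  move=> v0 cv; rewrite ge0_fin_numE//.
  by apply: integral_ge0 => y _; exact: conjugate_ge0.
have [adm Ephi Epsi] := semidual_pair ul u0 cu.
exists (fun x => (enorm x ^+ 2 - u x)%:E), (fun y => (enorm y ^+ 2)%:E - conjugate u y)%E.
split => // phi psi admpp.
have [v [k [[vl v0] [cv vpsi] vphi _]]] := semidual_improvement admpp.
have [_ iphi ipsi _] := admpp.
have [admv Evphi _] := semidual_pair vl v0 cv.
have {vphi}vphi : (\int[rho]_x phi x <= \int[rho]_x (enorm x ^+ 2)%:E -
    \int[rho]_x (v x)%:E - k%:E)%E.
  have ik := finite_measure_integrable_cst rho k measurableT.
  have [_ iv _ _] := admv.
  rewrite -Evphi -(integral_cst_probability rho) -(integralB measurableT iv ik).
  by apply: le_integral => //; exact: (integrableB measurableT iv ik).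
have := umin v (conj vl v0).
rewrite /dual_value Ephi Epsi.
have fr := integrable_fin_num measurableT (int_enorm2_fin rho2).
have fm := integrable_fin_num measurableT (int_enorm2_fin compact_second_moment).
have fphi := integrable_fin_num measurableT iphi.
have fpsi := integrable_fin_num measurableT ipsi.
move: vpsi vphi.
rewrite -(fineK fr) -(fineK fm) -(fineK fphi) -(fineK fpsi) -(fineK (ifin u ul)).
rewrite -(fineK (ifin v vl)) -(fineK (cfin u u0 cu)) -(fineK (cfin v v0 cv)).
by rewrite -!EFinB -!EFinD !lee_fin; lra.
Qed.

(** Improving [phi] cannot raise an optimal value, so the nonnegative gap [g] between the improved
    potential and [phi] has zero integral. Where it vanishes, [phi] inherits the almost-touching
    points. *)
Lemma dual_optimal_touching (phi psi : 'rV[R]_d -> \bar R) :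
  dual_optimal (@sqdist R d) rho mu phi psi ->
  {ae rho, forall x, phi x \is a fin_num /\ forall e, 0 < e ->
    exists y, [/\ Y y, psi y \is a fin_num &
      sqdist x y <= fine (phi x) + fine (psi y) + e]}.
Proof.
move=> [admpp opt].
have [u [k [[ul u0] [cu upsi] uphi uapp]]] := semidual_improvement admpp.
have [_ iphi ipsi _] := admpp.
have [admu Euphi Eupsi] := semidual_pair ul u0 cu.
have [_ iu _ _] := admu.
have := opt _ _ admu; rewrite /dual_value Eupsi.
have ik := finite_measure_integrable_cst rho k measurableT.
have iuk := integrableB measurableT iu ik.
have ig := integrableB measurableT iuk iphi.
pose g x := ((enorm (x : 'rV[R]_d) ^+ 2 - u x)%:E - k%:E - phi x)%E.
have g0 x : (0 <= g x)%E.
  rewrite /g; have := uphi x; case: (phi x) => [r| |]//=.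
    by rewrite !lee_fin; lra.
  by rewrite leey.
have Eg : (\int[rho]_x `|g x| = \int[rho]_x (enorm x ^+ 2 - u x)%:E - k%:E - \int[rho]_x phi x)%E.
  have -> : (fun x => `|g x|%E) = g by apply/funext => x; rewrite gee0_abs.
  rewrite (integralB measurableT iuk iphi) (integralB measurableT iu ik).
  by rewrite integral_cst_probability.
move=> optu.
have fm := integrable_fin_num measurableT (int_enorm2_fin compact_second_moment).
have fphi := integrable_fin_num measurableT iphi.
have fpsi := integrable_fin_num measurableT ipsi.
have fu := integrable_fin_num measurableT iu.
have fcu : (\int[mu]_y conjugate u y)%E \is a fin_num.
  rewrite ge0_fin_numE//.
  by apply: integral_ge0 => y _; exact: conjugate_ge0.
have Eg0 : (\int[rho]_x `|g x| = 0)%E.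
  apply/eqP; rewrite eq_le integral_ge0// andbT Eg.
  move: optu upsi.
  rewrite -(fineK fm) -(fineK fphi) -(fineK fpsi) -(fineK fu) -(fineK fcu).
  by rewrite -!EFinB -!EFinD !lee_fin; lra.
have mg : measurable_fun setT (g : borelV R d -> \bar R) by case/integrableP: ig.
have /(ae_eq_integral_abs rho measurableT mg) := Eg0.
apply: ae_imply => x /(_ I); rewrite /g.
have := uphi x; case Ep : (phi x) => [r| |]//= _ /eqP; rewrite eqe => /eqP h.
split => // e e0; have [y [Yy fy xy]] := uapp x e e0; exists y; split => //; lra.
Qed.

(* The average of two optimal pairs is optimal, so almost every [x] has a point
   [y] almost saturating the averaged constraint, hence both constraints. *)
Lemma dual_optimal_common_touching (phi0 psi0 phi1 psi1 : 'rV[R]_d -> \bar R) :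
  dual_optimal (@sqdist R d) rho mu phi0 psi0 ->
  dual_optimal (@sqdist R d) rho mu phi1 psi1 ->
  {ae rho, forall x, [/\ phi0 x \is a fin_num, phi1 x \is a fin_num &
    forall e, 0 < e -> exists y, [/\ Y y, psi0 y \is a fin_num, psi1 y \is a fin_num,
      sqdist x y <= fine (phi0 x) + fine (psi0 y) + e &
      sqdist x y <= fine (phi1 x) + fine (psi1 y) + e]]}.
Proof.
move=> o0 o1; have [a0 m0] := o0; have [a1 m1] := o1.
have [[p0 q0] ip0 iq0 c0] := a0; have [[p1 q1] ip1 iq1 c1] := a1.
pose avg (f g : 'rV[R]_d -> \bar R) x := ((2^-1)%:E * (f x + g x))%E.
have Eavg (nu : probability (borelV R d) R) (f g : 'rV[R]_d -> \bar R) :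
    nu.-integrable setT (f : borelV R d -> \bar R) ->
    nu.-integrable setT (g : borelV R d -> \bar R) ->
    nu.-integrable setT (avg f g : borelV R d -> \bar R) /\
    (\int[nu]_x avg f g x = (2^-1)%:E * (\int[nu]_x f x + \int[nu]_x g x))%E.
  move=> jf jg; have jfg := integrableD measurableT jf jg; split.
    exact: integrableZl.
  by rewrite (integralZl measurableT jfg) (integralD measurableT jf jg).
have [jp Ep] := Eavg _ _ _ ip0 ip1; have [jq Eq] := Eavg _ _ _ iq0 iq1.
(* The value -oo absorbs, so where an average is finite both of its terms are. *)
have avgP f g x : f x != +oo%E -> g x != +oo%E ->
    [/\ f x \is a fin_num, g x \is a fin_num &
       avg f g x = ((fine (f x) + fine (g x)) / 2)%:E] \/ avg f g x = -oo%E.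
  have h0 : (0 < (2^-1 : R)%:E)%E by rewrite lte_fin invr_gt0.
  rewrite /avg; case: (f x) => [r| |] // _; last by right; rewrite addNye gt0_muleNy.
  case: (g x) => [s| |] // _; last by right; rewrite addeNy gt0_muleNy.
  by left; split => //; rewrite -EFinD -EFinM mulrC.
have avgfin f g x : f x != +oo%E -> g x != +oo%E -> avg f g x \is a fin_num ->
    [/\ f x \is a fin_num, g x \is a fin_num &
       fine (avg f g x) = (fine (f x) + fine (g x)) / 2].
  by move=> foo goo; case: (avgP f g x foo goo) => [[? ? ->]|->].
have avgoo f g x : f x != +oo%E -> g x != +oo%E -> avg f g x != +oo%E.
  by move=> foo goo; case: (avgP f g x foo goo) => [[? ? ->]|->].
have aa : dual_admissible (@sqdist R d) rho mu (avg phi0 phi1) (avg psi0 psi1).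
  split; [by split=> x; exact: avgoo|exact: jp|exact: jq|].
  move=> x y; have := c0 x y; have := c1 x y.
  case: (avgP phi0 phi1 x (p0 x) (p1 x)) => [[f0 f1 ->]|->]; last by rewrite addNye leNye.
  case: (avgP psi0 psi1 y (q0 y) (q1 y)) => [[g0 g1 ->]|->]; last by rewrite addeNy leNye.
  rewrite -(fineK f0) -(fineK f1) -(fineK g0) -(fineK g1) -!EFinD !lee_fin.
  by move=> ? ?; rewrite /=; lra.
have Ev : dual_value rho mu phi0 psi0 = dual_value rho mu phi1 psi1.
  by apply/eqP; rewrite eq_le m0// m1.
have oa : dual_optimal (@sqdist R d) rho mu (avg phi0 phi1) (avg psi0 psi1).
  split => // f g /m0 h; apply: (le_trans h); move: Ev; rewrite /dual_value Ep Eq.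
  rewrite -(fineK (integrable_fin_num measurableT ip0)).
  rewrite -(fineK (integrable_fin_num measurableT ip1)).
  rewrite -(fineK (integrable_fin_num measurableT iq0)).
  rewrite -(fineK (integrable_fin_num measurableT iq1)).
  rewrite -!EFinD lee_fin => /eqP; rewrite eqe => /eqP; lra.
apply: ae_imply _ (dual_optimal_touching oa) => x [fx hx].
have [f0 f1 Ef] := avgfin _ _ _ (p0 x) (p1 x) fx; split => // e e0.
(* The slack of the averaged constraint is half the sum of two nonnegative slacks, so a bound e/2 on
   it bounds each of them by e. *)
have [|y [Yy fy]] := hx (e / 2); first by rewrite divr_gt0.
have [g0 g1 Eg] := avgfin _ _ _ (q0 y) (q1 y) fy; rewrite Ef Eg => h.
exists y; split => //.
  have := c1 x y; rewrite -(fineK f1) -(fineK g1) -EFinD lee_fin; lra.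
have := c0 x y; rewrite -(fineK f0) -(fineK g0) -EFinD lee_fin; lra.
Qed.

End compactly_supported.

(** * Oscillation of differences of potentials *)

(* Summation by parts: along an exact segment the increments
   [x_(i+1) - x_i] all equal [v / N], so the sum telescopes to a single product
   of size [|v| / N]; the deviations [r] only enter linearly in [N]. *)
Lemma chain_bound (R : realType) d (N : nat) (f : 'rV[R]_d -> R)
    (xs ys : nat -> 'rV[R]_d) (z v : 'rV[R]_d) (r K e : R) :
  (0 < N)%N -> 0 <= r -> 0 <= K ->
  (forall i, (i <= N)%N -> enorm (ys i) <= K) ->
  (forall i, (i <= N)%N -> enorm (xs i - (z + (i%:R / N%:R) *: v)) <= r) ->
  (forall i, (i < N)%N ->
    `|f (xs i.+1) - f (xs i)| <= 2 * dot (xs i.+1 - xs i) (ys i.+1 - ys i) + e) ->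
  `|f (xs N) - f (xs 0%N)| <= 4 * K * enorm v / N%:R + N%:R * (8 * r * K + e).
Proof.
move=> N0 r0 K0 yK xr fxy.
have Np : 0 < N%:R :> R by rewrite ltr0n.
pose E i := xs i - (z + (i%:R / N%:R) *: v).
(* The increments of [E] have length at most 2r and those of [ys] at most 2K, hence the error 2 * 2r
   * 2K = 8rK. *)
have step i : (i < N)%N -> 2 * dot (xs i.+1 - xs i) (ys i.+1 - ys i) <=
    2 / N%:R * dot v (ys i.+1 - ys i) + 8 * r * K.
  move=> iN.
  have -> : xs i.+1 - xs i = (E i.+1 - E i) + N%:R^-1 *: v.
    rewrite /E -[i.+1]addn1 natrD mulrDl mul1r scalerDl.
    by apply/rowP => j; rewrite !mxE; ring.
  rewrite dotDl dotZl.
  have h : dot (E i.+1 - E i) (ys i.+1 - ys i) <= (r + r) * (K + K).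
    apply: le_trans (dot_le_enorm _ _) _.
    apply: ler_pM; rewrite ?enorm_ge0//; apply: (le_trans (ler_enormB _ _)).
      by apply: lerD; apply: xr => //; exact: ltnW.
    by apply: lerD; apply: yK => //; exact: ltnW.
  by lra.
have part n : (n <= N)%N -> `|f (xs n) - f (xs 0%N)| <=
    2 / N%:R * dot v (ys n - ys 0%N) + n%:R * (8 * r * K + e).
  elim: n => [_|n IHn nN]; first by rewrite !subrr normr0 dotC dot0l mulr0 mul0r addr0.
  rewrite -(subrKA (f (xs n))); apply: (le_trans (ler_normD _ _)).
  have := fxy n nN; have := step n nN; have := IHn (ltnW nN).
  rewrite !dotBr -[n.+1]addn1 natrD; lra.
apply: le_trans (part N (leqnn N)) _; rewrite lerD2r.
have h : dot v (ys N - ys 0%N) <= enorm v * (K + K).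
  apply: le_trans (dot_le_enorm _ _) _; rewrite ler_wpM2l ?enorm_ge0//.
  by apply: (le_trans (ler_enormB _ _)); apply: lerD; exact: yK.
have -> : 4 * K * enorm v / N%:R = 2 / N%:R * (enorm v * (K + K)) by ring.
by rewrite ler_wpM2l// divr_ge0// ltW.
Qed.

(** N = floor(sqrt(l / r)) + 1 balances l / N against N r. The added 1 keeps N positive when l < r
    and costs the extra r. *)
Lemma optimal_step_count (R : realType) (l r : R) : 0 <= l -> 0 < r ->
  exists2 N : nat, (0 < N)%N &
    l / N%:R <= Num.sqrt l * Num.sqrt r /\ N%:R * r <= Num.sqrt l * Num.sqrt r + r.
Proof.
move=> l0 r0; have sr : 0 < Num.sqrt r by rewrite sqrtr_gt0.
pose s := Num.sqrt l / Num.sqrt r.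
have s0 : 0 <= s by rewrite divr_ge0// sqrtr_ge0.
have sE : Num.sqrt l = s * Num.sqrt r by rewrite /s divfK// gt_eqF.
have rE : Num.sqrt r * Num.sqrt r = r by rewrite -expr2 sqr_sqrtr// ltW.
have lE : s * s * r = l.
  by rewrite -[RHS](sqr_sqrtr l0) sE exprMn (sqr_sqrtr (ltW r0)) expr2.
have /andP[sN Ns] := truncn_itv s0.
have Nss : 0 <= (Num.truncn s).+1%:R - s by rewrite subr_ge0 ltW.
exists (Num.truncn s).+1 => //; split.
  rewrite sE -mulrA rE -lE ler_pdivrMr ?ltr0n//.
  by have := mulr_ge0 (mulr_ge0 s0 (ltW r0)) Nss; lra.
by rewrite sE -mulrA rE -[X in _ <= _ + X]mul1r -mulrDl ler_pM2r// -natr1 lerD2r.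
Qed.

Lemma sqrtr_leD (R : realType) (a b : R) : 0 <= a -> 0 <= b ->
  Num.sqrt (a + b) <= Num.sqrt a + Num.sqrt b.
Proof.
move=> a0 b0; have sa := sqrtr_ge0 a; have sb := sqrtr_ge0 b.
rewrite -[leRHS]ger0_norm ?addr_ge0// -sqrtr_sqr ler_wsqrtr//.
have := sqr_sqrtr a0; have := sqr_sqrtr b0; nra.
Qed.

(** The factor 1 + M dominates M^(1/q) for every q >= 1, so the bound does not involve q; the final
    constant inherits this. *)
Lemma Lnorm_affine_bound (disp : measure_display) (T : measurableType disp)
    (R : realType) (P : probability T R) (q M a b : R) (s : T -> R) (g : T -> \bar R) :
  1 <= q -> 0 <= M -> 0 <= a -> 0 <= b ->
  measurable_fun setT s -> measurable_fun setT g -> (forall x, 0 <= s x) ->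
  (\int[P]_x (s x `^ q)%:E <= M%:E)%E ->
  {ae P, forall x, (`|g x| <= (a * s x + b)%:E)%E} ->
  (Lnorm P q%:E g <= (4 * (a * (1 + M) + b))%:E)%E.
Proof.
move=> q1 M0 a0 b0 ms mg s0 sM gs.
have q0 : 0 < q by apply: lt_le_trans q1.
(* Rescaling by m >= 1 gives (s/m)^q <= s^q / m, whose integral is at most M/m <= 1. *)
pose m := 1 + M; have m1 : 1 <= m by rewrite /m lerDl.
have mp : 0 < m by apply: lt_le_trans m1.
pose k := a * m + b; have k0 : 0 <= k by rewrite addr_ge0// mulr_ge0// ltW.
have pw x : (a * s x + b) `^ q <= (2 * k) `^ q * (m^-1 * s x `^ q + 1).
  have sx := s0 x.
  have t0 : 0 <= s x / m by rewrite divr_ge0// ltW.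
  pose t := Num.max (s x / m) 1.
  have tp : 0 <= t by rewrite le_max t0.
  have le1 : a * s x + b <= 2 * k * t.
    have st : s x <= m * t by rewrite mulrC -ler_pdivrMr// le_max lexx.
    have t1 : 1 <= t by rewrite le_max lexx orbT.
    have h1 : a * s x <= a * m * t by rewrite -mulrA ler_wpM2l.
    have h2 : b <= b * t by rewrite ler_peMr.
    have h3 : 0 <= k * t by rewrite mulr_ge0.
    by rewrite /k in h3 *; lra.
  apply: (@le_trans _ _ ((2 * k * t) `^ q)).
    by apply: ge0_ler_powR; rewrite ?nnegrE ?(ltW q0)// ?mulr_ge0// addr_ge0// mulr_ge0.
  rewrite powRM ?mulr_ge0//; apply: ler_wpM2l; first exact: powR_ge0.
  have h : (s x / m) `^ q <= m^-1 * s x `^ q.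
    rewrite powRM ?invr_ge0 ?(ltW mp)// mulrC ler_wpM2r ?powR_ge0//.
    apply: ge1r_powR => //; by rewrite invr_gt0 mp/= invf_le1.
  have h0 : 0 <= m^-1 * s x `^ q by rewrite mulr_ge0 ?powR_ge0// invr_ge0 ltW.
  rewrite /t; case: (leP (s x / m) 1) => _; first by rewrite powR1; lra.
  by lra.
have mpow : measurable_fun setT (fun x => s x `^ q).
  exact: (measurableT_comp (measurable_powR q) ms).
have int1 : (\int[P]_x `|g x| `^ q <= \int[P]_x ((2 * k) `^ q * (m^-1 * s x `^ q + 1))%:E)%E.
  apply: ae_ge0_le_integral => //.
  - by move=> x _; exact: poweR_ge0.
  - by apply: (measurableT_comp (measurable_poweR q)); exact: measurableT_comp.
  - move=> x _; rewrite lee_fin mulr_ge0 ?powR_ge0// addr_ge0// mulr_ge0 ?powR_ge0//.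
    by rewrite invr_ge0 ltW.
  - apply/measurable_EFinP; apply: measurable_funM => //; apply: measurable_funD => //.
    exact: measurable_funM.
  apply: filterS gs => x gx _.
  have asb : 0 <= a * s x + b by rewrite addr_ge0// mulr_ge0.
  apply: (@le_trans _ _ (((a * s x + b) `^ q)%:E)); last by rewrite lee_fin pw.
  rewrite -poweR_EFin; apply: gt0_ler_poweR => //; first exact: ltW.
    by rewrite in_itv/= abse_ge0 leey.
  by rewrite in_itv/= lee_fin asb leey.
have int2 : (\int[P]_x ((2 * k) `^ q * (m^-1 * s x `^ q + 1))%:E <= ((4 * k) `^ q)%:E)%E.
  under eq_integral do rewrite EFinM EFinD.
  rewrite ge0_integralZl//=; last 3 first.
  - apply: emeasurable_funD => //; apply/measurable_EFinP; exact: measurable_funM.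
  - move=> x _; rewrite -EFinD lee_fin addr_ge0// mulr_ge0 ?powR_ge0// invr_ge0 ltW//.
  - by rewrite lee_fin powR_ge0.
  rewrite ge0_integralD//=; last 2 first.
  - by move=> x _; rewrite lee_fin mulr_ge0 ?powR_ge0// invr_ge0 ltW.
  - apply/measurable_EFinP; exact: measurable_funM.
  rewrite integral_cst_probability.
  under eq_integral do rewrite EFinM.
  rewrite ge0_integralZl//=; last 3 first.
  - exact/measurable_EFinP.
  - by move=> x _; rewrite lee_fin powR_ge0.
  - by rewrite lee_fin invr_ge0 ltW.
  (* The integral M/m + 1 <= 2 is absorbed through 2 <= 2^q, which turns 2k into 4k. *)
  have -> : 4 * k = 2 * k * 2 by ring.
  rewrite [leRHS](_ : _ = ((2 * k) `^ q)%:E * (2 `^ q)%:E)%E; last by rewrite powRM ?mulr_ge0.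
  apply: lee_wpmul2l; first by rewrite lee_fin powR_ge0.
  apply: (@le_trans _ _ (1 + 1)%:E); last first.
    rewrite lee_fin; have : 2 <= 2 `^ q :> R by apply: le1r_powR => //; rewrite ler1n.
    by lra.
  rewrite EFinD leeD2r//; apply: (@le_trans _ _ (m^-1%:E * M%:E)%E).
    by apply: lee_wpmul2l => //; rewrite lee_fin invr_ge0 ltW.
  by rewrite -EFinM lee_fin mulrC ler_pdivrMr// mul1r /m; lra.
rewrite unlock.
have -> : 4 * (a * (1 + M) + b) = ((4 * k) `^ q) `^ q^-1.
  by rewrite -powRrM divff ?gt_eqF// powRr1// mulr_ge0.
rewrite -poweR_EFin; apply: gt0_ler_poweR.
- by rewrite invr_ge0 ltW.
- by rewrite in_itv/= leey andbT integral_ge0// => x _; exact: poweR_ge0.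
- by rewrite in_itv/= lee_fin powR_ge0 leey.
- exact: le_trans int1 int2.
Qed.

(** A ball about a support point has positive mass, so it cannot lie inside the null set where [Q]
    fails. *)
Lemma spt_ae_dense (R : realType) d (rho : probability (borelV R d) R)
    (Q : 'rV[R]_d -> Prop) (a : 'rV[R]_d) (e : R) :
  {ae rho, forall x, Q x} -> spt rho a -> 0 < e ->
  exists2 x, Q x & enorm (x - a) < e.
Proof.
move=> [N [mN N0 QN]] sa e0; apply: contrapT => nQ.
have oB := @open_enorm_ball R d a e.
have : (0 < rho [set y | (enorm (y - a) < e)%R])%E.
  by apply: sa => //=; rewrite subrr enormE dot0l sqrtr0.
rewrite ltNge => /negP; apply; rewrite -N0.
apply: le_measure; rewrite ?inE//; first exact: borelV_open.
by move=> x /= xa; apply: QN => Qx; apply: nQ; exists x.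
Qed.

Lemma set_dist_ge0 (R : realType) d (x : 'rV[R]_d) (A : set 'rV[R]_d) :
  (0 <= set_dist x A)%E.
Proof. by apply: le_ereal_inf_tmp => _ [a _ <-]; rewrite lee_fin enorm_ge0. Qed.

(** Infima need not be attained; the strict inequality is what produces actual points. *)
Lemma hausdorff_dist_lt (R : realType) d (A B : set 'rV[R]_d) (r : R) :
  (hausdorff_dist A B < r%:E)%E ->
  (forall x, A x -> exists2 y, B y & enorm (x - y) < r) /\
  (forall x, B x -> exists2 y, A y & enorm (x - y) < r).
Proof.
have gen (C D : set 'rV[R]_d) : (ereal_sup [set set_dist x D | x in C] < r%:E)%E ->
    forall x, C x -> exists2 y, D y & enorm (x - y) < r.
  move=> h x Cx; have : (set_dist x D < r%:E)%E.
    by apply: le_lt_trans h; apply: ereal_sup_ubound; exists x.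
  by move=> /ereal_inf_lt[_ [y Dy <-]]; rewrite lte_fin => ?; exists y.
by rewrite /hausdorff_dist gt_max => /andP[h1 h2]; split; exact: gen.
Qed.

(** The support has full mass, hence is nonempty, which rules out the value -oo of a supremum over
    the empty set. *)
Lemma hausdorff_dist_spt_ge0 (R : realType) d (rho : probability (borelV R d) R)
    (B : set 'rV[R]_d) : (0 <= hausdorff_dist (spt rho) B)%E.
Proof.
have [x sx] := @ae_exists _ (borelV R d) _ rho _ (ae_spt rho).
rewrite /hausdorff_dist le_max; apply/orP; left.
by apply: le_trans (set_dist_ge0 x B) _; apply: ereal_sup_ubound; exists x.
Qed.

(* The difference of two potentials moves by at most the monotonicity gap of
   any common (approximate) subgradients. *)
Lemma touching_monotone (R : realType) d (phi0 phi1 psi0 psi1 : 'rV[R]_d -> R)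
    (x x' y y' : 'rV[R]_d) (e : R) :
  phi0 x' + psi0 y <= sqdist x' y -> sqdist x y <= phi0 x + psi0 y + e ->
  phi1 x + psi1 y' <= sqdist x y' -> sqdist x' y' <= phi1 x' + psi1 y' + e ->
  (phi0 x' - phi1 x') - (phi0 x - phi1 x) <= 2 * dot (x' - x) (y' - y) + 2 * e.
Proof. by rewrite !sqdistE dotBl !dotBr; lra. Qed.

(** * Oscillation along segments of the star-shaped set, and its L^q norm *)

Section oscillation.
Context (R : realType) (d : nat) (rho mu : probability (borelV R d) R).
Context (Y Omega : set 'rV[R]_d) (z : 'rV[R]_d) (K : R).
Hypotheses (rho2 : finite_second_moment rho) (compactY : compact Y) (K1 : 1 <= K).
Hypotheses (YK : forall y, Y y -> enorm y <= K) (muY : mu Y = 1%E).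
Hypothesis starO : star_center Omega z.

Lemma potential_difference_oscillation (phi0 psi0 phi1 psi1 : 'rV[R]_d -> \bar R) (r : R) :
  dual_optimal (@sqdist R d) rho mu phi0 psi0 ->
  dual_optimal (@sqdist R d) rho mu phi1 psi1 ->
  0 < r -> (hausdorff_dist (spt rho) Omega < r%:E)%E ->
  exists l : R, {ae rho, forall x, (`|phi0 x - phi1 x - l%:E| <=
    (14 * K * Num.sqrt r * Num.sqrt (enorm (x : 'rV[R]_d)) +
     (14 * K * Num.sqrt r * Num.sqrt (enorm z) + 24 * K * r))%:E)%E}.
Proof.
move=> o0 o1 r0 /hausdorff_dist_lt[sO Os].
have aeT := dual_optimal_common_touching rho2 compactY YK muY o0 o1.
have [[_ _ _ c0] _] := o0; have [[_ _ _ c1] _] := o1.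
have Kp : 0 < K by apply: lt_le_trans K1.
(* [r * K] is the touching tolerance: of the same order as the deviation error 8rK, it brings the
   cost per step to 10rK. *)
have e0 : 0 < r * K by rewrite mulr_gt0.
set T := (fun x : 'rV[R]_d => _) in aeT.
(* A support point lies within r of a, and points of [T] are dense near it; the remaining margin
   keeps the total distance below r. *)
have near_T a : Omega a -> exists2 x, T x & enorm (x - a) < r.
  move=> /Os[b sb ab]; have h : 0 < r - enorm (a - b) by rewrite subr_gt0.
  have [x Tx xb] := spt_ae_dense aeT sb h; exists x => //.
  have := ler_enormD (x - b) (b - a); rewrite subrKA (enorm_distC b a).
  by move=> /le_lt_trans; apply; rewrite -ltrBrDr.
(* A finite distance to the nonempty support forces [Omega] to be nonempty; t = 0 on any segment
   then gives the centre. *)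
have Oz : Omega z.
  have [x sx] := @ae_exists _ (borelV R d) _ rho _ (ae_spt rho).
  have [a Oa _] := sO x sx.
  by have := starO Oa (t := 0); rewrite subr0 scale1r scale0r addr0; apply; rewrite lexx ler01.
have [x0 Tx0 x0z] := near_T z Oz.
pose f x := fine (phi0 x) - fine (phi1 x).
exists (f x0).
apply: ae_imply2 _ aeT (ae_spt rho) => x Tx sx.
have [a Oa xa] := sO x sx.
have [N N0 [Nl Nr]] := optimal_step_count (enorm_ge0 (a - z)) r0.
have Np : 0 < N%:R :> R by rewrite ltr0n.
pose touch (x y : 'rV[R]_d) := [/\ Y y, psi0 y \is a fin_num, psi1 y \is a fin_num,
  sqdist x y <= fine (phi0 x) + fine (psi0 y) + r * K &
  sqdist x y <= fine (phi1 x) + fine (psi1 y) + r * K].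
(* The chain starts at the fixed [x0] and ends at x, so that [l] does not depend on x; beyond N the
   value is a dummy. *)
have /choice[p pP] : forall i : nat, exists p : 'rV[R]_d * 'rV[R]_d, (i <= N)%N ->
    [/\ T p.1, touch p.1 p.2, enorm (p.1 - (z + (i%:R / N%:R) *: (a - z))) <= r,
      (i = 0%N -> p.1 = x0) & (i = N -> p.1 = x)].
  move=> i; have [iN|iN] := leqP i N; last by exists (0, 0).
  suff [x' [Tx' dx' h1 h2]] : exists x', [/\ T x',
      enorm (x' - (z + (i%:R / N%:R) *: (a - z))) <= r,
      (i = 0%N -> x' = x0) & (i = N -> x' = x)].
    have [_ _ /(_ _ e0)[y Ty]] := Tx'.
    by exists (x', y).
  have [i0|i0] := eqVneq i 0%N.
    exists x0; split => //; first by rewrite i0 mul0r scale0r addr0 ltW.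
    by move=> iN0; move: N0; rewrite -iN0 i0.
  have [iN1|iN1] := eqVneq i N.
    exists x; split => //; first by rewrite iN1 divff ?gt_eqF// scale1r [z + _]addrC subrK ltW.
    by move=> i00; rewrite i00 eqxx in i0.
  have Oi : Omega (z + (i%:R / N%:R) *: (a - z)).
    have := starO Oa (t := i%:R / N%:R).
    rewrite (_ : (1 - i%:R / N%:R) *: z + (i%:R / N%:R) *: a =
      z + (i%:R / N%:R) *: (a - z)); last by apply/rowP => j; rewrite !mxE; ring.
    by apply; rewrite divr_ge0//= ler_pdivrMr// mul1r ler_nat.
  have [x' Tx' dx'] := near_T _ Oi; exists x'; split => //; first exact: ltW.
    by move=> h; rewrite h eqxx in i0.
  by move=> h; rewrite h eqxx in iN1.
have ineq x' y' x'' y'' : T x' -> T x'' -> touch x' y' -> touch x'' y'' ->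
    f x'' - f x' <= 2 * dot (x'' - x') (y'' - y') + 2 * (r * K).
  move=> [f0 f1 _] [f0' f1' _] [_ g0 g1 t0 t1] [_ g0' g1' t0' t1'].
  apply: (@touching_monotone R d (fine \o phi0) (fine \o phi1)
    (fine \o psi0) (fine \o psi1)) => //=.
    by rewrite -lee_fin EFinD !fineK.
  by rewrite -lee_fin EFinD !fineK.
have := @chain_bound R d N f (fun i => (p i).1) (fun i => (p i).2)
  z (a - z) r K (2 * (r * K)) N0 (ltW r0) (ltW Kp).
have [_ _ _ p0 _] := pP 0%N (leq0n N); have [_ _ _ _ pN] := pP N (leqnn N).
rewrite (p0 erefl) (pN erefl) => bnd.
have {bnd}bnd : `|f x - f x0| <= 4 * K * enorm (a - z) / N%:R + N%:R * (8 * r * K + 2 * (r * K)).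
  apply: bnd => [i iN|i iN|i iN].
  - by have [_ [/YK]] := pP i iN.
  - by have [] := pP i iN.
  - have [Ti ti _ _ _] := pP i (ltnW iN); have [Tj tj _ _ _] := pP i.+1 iN.
    rewrite ler_norml (ineq _ _ _ _ Ti Tj ti tj) andbT.
    have := ineq _ _ _ _ Tj Ti tj ti.
    by rewrite -(opprB (p i.+1).1) -(opprB (p i.+1).2) dotNl dotC dotNl opprK dotC; lra.
have [f0 f1 _] := Tx.
rewrite -(fineK f0) -(fineK f1) -!EFinB abse_EFin lee_fin -/(f x).
apply: (le_trans bnd).
set S := Num.sqrt (enorm (a - z)) * Num.sqrt r in Nl Nr.
(* |a - z| <= |x| + |z| + r, and the square root is subadditive. *)
have SE : S <= Num.sqrt r * Num.sqrt (enorm x) + Num.sqrt r * Num.sqrt (enorm z) + r.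
  rewrite -[X in _ + X](sqr_sqrtr (ltW r0)) expr2 -!mulrDr /S mulrC ler_wpM2l ?sqrtr_ge0//.
  apply: (@le_trans _ _ (Num.sqrt (enorm x + enorm z + r))).
    apply: ler_wsqrtr; have := ler_enormD (a - x) (x - z); rewrite subrKA.
    have := ler_enormB x z; rewrite enorm_distC in xa; lra.
  apply: (le_trans (sqrtr_leD _ (ltW r0))); first by rewrite addr_ge0 ?enorm_ge0.
  by rewrite lerD2r sqrtr_leD ?enorm_ge0.
have h1 : 4 * K * enorm (a - z) / N%:R <= 4 * K * S.
  by rewrite -mulrA ler_wpM2l// mulr_ge0// ltW.
have h2 : N%:R * (8 * r * K + 2 * (r * K)) <= 10 * K * (S + r).
  have -> : N%:R * (8 * r * K + 2 * (r * K)) = 10 * K * (N%:R * r) by ring.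
  by rewrite ler_wpM2l// mulr_ge0// ltW.
have h3 : 14 * K * S <= 14 * K *
    (Num.sqrt r * Num.sqrt (enorm x) + Num.sqrt r * Num.sqrt (enorm z) + r).
  by rewrite ler_wpM2l// mulr_ge0// ltW.
(* 4KS + 10K(S + r) = 14KS + 10Kr, and the bound on S adds 14Kr, whence the coefficients 14 and
   24. *)
by lra.
Qed.

(** The affine bound is applied with s = |x|^(1/2), whose q-th moment is the assumed moment of order
    q/2. *)
Lemma potential_difference_Lnorm (phi0 psi0 phi1 psi1 : 'rV[R]_d -> \bar R) (q M r : R) :
  dual_optimal (@sqdist R d) rho mu phi0 psi0 ->
  dual_optimal (@sqdist R d) rho mu phi1 psi1 ->
  1 <= q -> 0 <= M -> (\int[rho]_x (enorm x `^ (q / 2))%:E <= M%:E)%E ->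
  0 < r -> (hausdorff_dist (spt rho) Omega < r%:E)%E ->
  exists l : R, (Lnorm rho q%:E (fun x => phi0 x - phi1 x - l%:E) <=
    (96 * K * (1 + M + Num.sqrt (enorm z)) * (Num.sqrt r + r))%:E)%E.
Proof.
move=> o0 o1 q1 M0 rhoM r0 hr.
have [l lP] := potential_difference_oscillation o0 o1 r0 hr.
exists l.
have [[_ /integrableP[mphi0 _] _ _] _] := o0.
have [[_ /integrableP[mphi1 _] _ _] _] := o1.
have Kp : 0 < K by apply: lt_le_trans K1.
have a0 : 0 <= 14 * K * Num.sqrt r by rewrite !mulr_ge0 ?sqrtr_ge0// ltW.
have b0 : 0 <= 14 * K * Num.sqrt r * Num.sqrt (enorm z) + 24 * K * r.
  by rewrite addr_ge0// !mulr_ge0 ?sqrtr_ge0// ltW.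
have menorm : measurable_fun (setT : set (borelV R d)) (@enorm R d).
  by apply: borelV_measurable_cont; exact: enorm_continuous.
apply: le_trans (@Lnorm_affine_bound _ (borelV R d) R rho q M _ _
   (fun x => enorm x `^ 2^-1) _ q1 M0 a0 b0 _ _ _ _ _) _.
- exact: (measurableT_comp (measurable_powR 2^-1) menorm).
- apply: emeasurable_funB; last exact: measurable_cst.
  exact: emeasurable_funB.
- by move=> x; exact: powR_ge0.
- by under eq_integral do rewrite -powRrM mulrC.
- by apply: ae_imply _ lP => x; rewrite powR12_sqrt ?enorm_ge0.
(* The factor 96 is 4 * 24; the terms in sqrt(r) carry 4 * 14 = 56. *)
rewrite lee_fin.
have sr := sqrtr_ge0 r; have sz := sqrtr_ge0 (enorm z).
set s := Num.sqrt r in sr *; set t := Num.sqrt (enorm z) in sz *.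
have k1 : 0 <= K * s * (1 + M + t).
  by rewrite !mulr_ge0 ?(ltW Kp)// !addr_ge0.
have k2 : 0 <= K * r * (M + t) by rewrite !mulr_ge0 ?(ltW Kp) ?(ltW r0)// addr_ge0.
by lra.
Qed.

End oscillation.

(** The radius has to exceed the Hausdorff distance strictly. With r' = r + s^2 and s <= 1, both the
    square root and the linear term grow by at most s, so the excess is at most 2Cs <= e. *)
Lemma sqrt_affine_approx (R : realType) (C r e : R) : 0 < C -> 0 <= r -> 0 < e ->
  exists2 r' : R, r < r' & C * (Num.sqrt r' + r') <= C * (Num.sqrt r + r) + e.
Proof.
move=> C0 r0 e0; pose s := Num.min 1 (e / (2 * C)).
have s0 : 0 < s by rewrite lt_min ltr01 divr_gt0// mulr_gt0.
have s1 : s <= 1 by rewrite ge_min lexx.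
have se : 2 * C * s <= e by rewrite mulrC -ler_pdivlMr ?mulr_gt0// ge_min lexx orbT.
exists (r + s ^+ 2); first by rewrite ltrDl exprn_gt0.
have h : Num.sqrt (r + s ^+ 2) <= Num.sqrt r + s.
  by apply: le_trans (sqrtr_leD r0 (sqr_ge0 s)) _; rewrite sqrtr_sqr gtr0_norm.
have h2 : s ^+ 2 <= s by rewrite expr2 ger_pMl.
apply: (@le_trans _ _ (C * (Num.sqrt r + r + 2 * s))); last by lra.
by rewrite ler_wpM2l ?(ltW C0)//; lra.
Qed.

(** * The diameter bound *)

Unset Implicit Arguments.

Theorem theorem1p6 (R : realType) (d : nat) (z' : 'rV[R]_d)
    (Y : set 'rV[R]_d) (compactY : compact Y) (M : R) (M_gt0 : 0 < M) :
  exists2 C : R, 0 < C &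
  forall (Omega : set 'rV[R]_d) (q : R), star_center Omega z' -> 1 <= q ->
  forall rho mu : probability (borelV R d) R,
    finite_second_moment rho ->
    (\int[rho]_x (enorm x `^ (q / 2))%:E <= M%:E)%E ->
    mu Y = 1%E ->
    kantorovich_potentials (@sqdist R d) rho mu !=set0 /\
    (diam_Lq rho q (kantorovich_potentials (@sqdist R d) rho mu) <=
      C%:E * (hausdorff_dist (spt rho) Omega `^ (2^-1) +
              hausdorff_dist (spt rho) Omega))%E.
Proof.
have [K K1 YK] := compact_enorm_bounded compactY.
have Kp : 0 < K by apply: lt_le_trans K1.
(* Depends only on [M], [z'] and, through [K], on [Y]. *)
pose C := 96 * K * (1 + M + Num.sqrt (enorm z')).
have C0 : 0 < C by rewrite mulr_gt0 ?mulr_gt0// ltr_pwDl ?sqrtr_ge0// addr_gt0.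
exists C => // Omega q starO q1 rho mu rho2 rhoM muY; split.
  exact: kantorovich_potentials_nonempty rho2 compactY YK muY.
apply: ge_ereal_sup => _ [phi0 [phi1 [[psi0 o0] [psi1 o1] ->]]].
have := hausdorff_dist_spt_ge0 rho Omega.
case E : (hausdorff_dist (spt rho) Omega) => [r| |] // r0; last first.
  (* At infinite distance the right-hand side is +oo since [K], and with it [C], is positive. *)
  by rewrite poweRyr ?invr_eq0// addye// gt0_muley ?lte_fin// leey.
rewrite lee_fin in r0.
(* The estimate holds at every radius above r; an arbitrary excess e brings it down to r itself. *)
rewrite poweR_EFin powR12_sqrt// -EFinD -EFinM; apply/lee_addgt0Pr => e e0.
have [r' rr' hr'] := sqrt_affine_approx C0 r0 e0.
have [||l lP] := @potential_difference_Lnorm R d rho mu Y Omega z' K rho2 compactY K1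
  YK muY starO phi0 psi0 phi1 psi1 q M r' o0 o1 q1 (ltW M_gt0) rhoM.
- exact: le_lt_trans rr'.
- by rewrite E lte_fin.
apply: le_trans (le_trans lP _).
  by apply: ereal_inf_lbound; exists l.
by rewrite -EFinD lee_fin.
Qed.
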